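(* There exists a zero-sum product stochastic game $\Gamma=(X,Y,A,B,p,q,u)$ which is weakly communicating on both sides (i.e. both players have the weak communication property) and which does not admit an asymptotic value.
   Context: Zero-sum product stochastic game: $X,Y$ are nonempty finite sets (state spaces of players 1 and 2); $A,B$ are nonempty compact metric sets (action sets of players 1 and 2) with their Borel $\sigma$-algebras; $p:X\times A\to\Delta(X)$ and $q:Y\times B\to\Delta(Y)$ are such that $p(x'|x,\cdot)$ and $q(y'|y,\cdot)$ are continuous for all $x,x'\in X$, $y,y'\in Y$; $u:X\times Y\times A\times B\to[0,1]$ is such that $u(x,y,\cdot,b)$ and $u(x,y,a,\cdot)$ are continuous for all $(x,y)$, $a$, $b$. $\Delta(S)$ is the set of (Borel) probability measures on $S$. Play: an initial state $(x_1,y_1)$ is given and known. At stage $n$, knowing the history $h_n=(x_1,y_1,a_1,b_1,\dots,x_n,y_n)$, the players simultaneously choose $a_n\in A$, $b_n\in B$; then $x_{n+1}\sim p(\cdot|x_n,a_n)$ and $y_{n+1}\sim q(\cdot|y_n,b_n)$ are drawn (independently). The stage payoff to player 1 (who maximizes; player 2 minimizes) is $u_n=u(x_n,y_n,a_n,b_n)$. Behavior strategies $\boldsymbol\sigma,\boldsymbol\tau$ are sequences of measurable maps from joint histories $h_n$ to $\Delta(A)$, resp. $\Delta(B)$. A policy $\sigma\in\mathcal S$ of player 1 is a sequence of measurable maps $\sigma_n$ from player 1's own histories $(x_1,a_1,\dots,a_{n-1},x_n)$ to $\Delta(A)$; with an initial state $x$ it defines a law $\mathbb P^x_\sigma$ of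 the process $(X_n)_{n\ge1}$ of player 1's states. Player 1 has the weak communication property if there exist an integer $T\ge1$ and a policy $\sigma\in\mathcal S$ such that for all $x,x'\in X$, $\mathbb P^x_\sigma(X_T=x')>0$. Similarly for player 2 (with $Y$, $q$). For $N\ge1$, $v_N(x,y)$ is the value of the game starting at $(x,y)$ with payoff $\frac1N\sum_{n=1}^N\mathbb E^{x,y}_{\boldsymbol\sigma,\boldsymbol\tau}(u_n)$. For $\lambda\in(0,1]$, $v_\lambda(x,y)$ is the value of the game starting at $(x,y)$ with payoff $\lambda\sum_{n\ge1}(1-\lambda)^{n-1}\mathbb E^{x,y}_{\boldsymbol\sigma,\boldsymbol\tau}(u_n)$. The game has an asymptotic value if $v_N$ (as $N\to\infty$) and $v_\lambda$ (as $\lambda\to0$) converge on $X\times Y$ and the limits are equal. *)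

(* Defs.v *)
From HB Require Import structures.
From mathcomp Require Import all_boot all_order all_algebra.
From mathcomp Require Import all_classical all_reals all_analysis.
(* Not exported by all_analysis; needed for the sigma-algebra of \bar R. *)
From mathcomp Require Import measurable_realfun.

Set Implicit Arguments.
Unset Strict Implicit.
Unset Printing Implicit Defensive.

Import Order.TTheory GRing.Theory Num.Theory.
Import numFieldNormedType.Exports.

Local Open Scope classical_set_scope.
Local Open Scope ring_scope.

(* Measurable types are pointed in the library, so nonemptiness of the state
   and action sets is expressed by pointed structures. *)
#[short(type="pfinType")]
HB.structure Definition PointedFinite := { T of Finite T & Pointed T }.

#[short(type="pmetricType")]
HB.structure Definition PointedMetric (K : numDomainType) :=
  { M of Metric K M & Pointed M }.

Notation disc X := (g_sigma_algebraType [set: set X]).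
Notation borel A := (g_sigma_algebraType (@open A)).

Section kpre.
Context (R : realType) d0 d1 d2 (T0 : measurableType d0)
  (T1 : measurableType d1) (T2 : measurableType d2).

Definition kpre (f : T0 -> T1) (mf : measurable_fun [set: T0] f)
    (k : R.-pker T1 ~> T2) : T0 -> {measure set T2 -> \bar R} :=
  fun t => k (f t).

Variables (f : T0 -> T1) (mf : measurable_fun [set: T0] f)
  (k : R.-pker T1 ~> T2).

Let measurable_kpre U : measurable U ->
  measurable_fun [set: T0] (kpre mf k ^~ U).
Proof.
move=> mU; apply: (@measurableT_comp _ _ _ _ _ _ (fun t => k t U)) => //.
exact: measurable_kernel.
Qed.

HB.instance Definition _ := isKernel.Build _ _ _ _ R (kpre mf k) measurable_kpre.

Let kpre_setT t : kpre mf k t setT = 1%E.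
Proof. exact: prob_kernel. Qed.

HB.instance Definition _ :=
  Kernel_isProbability.Build _ _ _ _ R (kpre mf k) kpre_setT.

End kpre.

Section kdprod.
Context (R : realType) d0 d1 d2 (T0 : measurableType d0)
  (T1 : measurableType d1) (T2 : measurableType d2).

(* The library does not register mkproduct as a probability kernel. *)
Definition kdprod (k1 : R.-pker T0 ~> T1) (k2 : R.-pker (T0 * T1) ~> T2) :
  T0 -> {measure set (T1 * T2) -> \bar R} := mkproduct k1 k2.

Variables (k1 : R.-pker T0 ~> T1) (k2 : R.-pker (T0 * T1) ~> T2).

HB.instance Definition _ := Kernel.on (kdprod k1 k2).

Let kdprod_setT t : kdprod k1 k2 t setT = 1%E.
Proof.
transitivity (\int[k1 t]_y cst 1%E y)%E; last first.
  by rewrite integral_cst// mul1e; exact: prob_kernel.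
apply: eq_integral => y _.
transitivity (\int[k2 (t, y)]_z cst 1%E z)%E; last first.
  by rewrite integral_cst// mul1e; exact: prob_kernel.
by apply: eq_integral => z _; rewrite indicT.
Qed.

HB.instance Definition _ :=
  Kernel_isProbability.Build _ _ _ _ R (kdprod k1 k2) kdprod_setT.

End kdprod.

Section kindep.
Context (R : realType) d0 d1 d2 (T0 : measurableType d0)
  (T1 : measurableType d1) (T2 : measurableType d2).

(* t |-> k1(t) (x) k2(t), the two coordinates being independent. *)
Definition kindep (k1 : R.-pker T0 ~> T1) (k2 : R.-pker T0 ~> T2) :
    R.-pker T0 ~> (T1 * T2)%type :=
  kdprod k1 (kpre (@measurable_fst _ _ T0 T1) k2).
End kindep.

Section plays.
Context (R : realType) dS dA (S : measurableType dS) (A : measurableType dA).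

Fixpoint hist_disp (n : nat) : measure_display :=
  if n is m.+1 then
    measure_prod_display (hist_disp m, measure_prod_display (dA, dS))
  else dS.

(* hist n = S * (A * S)^n: indices start at 0, so hist n is the space of the
   histories available at stage n.+1. *)
Fixpoint hist (n : nat) : measurableType (hist_disp n) :=
  match n with
  | 0 => S
  | m.+1 => [the measurableType (measure_prod_display _)
              of (hist m * (A * S))%type]
  end.

Definition cur (n : nat) : hist n -> S :=
  match n with 0 => id | m.+1 => fun h => h.2.2 end.

Lemma measurable_cur n : measurable_fun [set: hist n] (@cur n).
Proof.
case: n => [|n]; first exact: measurable_id.
exact: (measurableT_comp measurable_snd measurable_snd).
Qed.

Definition policy := forall n, R.-pker (hist n) ~> A.

Lemma measurable_cur_act n : measurable_fun [set: hist n * A]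
  (fun ha : hist n * A => (cur ha.1, ha.2)).
Proof.
apply: measurable_fun_pair; last exact: measurable_snd.
exact: (measurableT_comp (@measurable_cur n) measurable_fst).
Qed.

Definition step (q : R.-pker (S * A) ~> S) (sigma : policy) n :
    R.-pker (hist n) ~> (A * S)%type :=
  kdprod (sigma n) (kpre (@measurable_cur_act n) q).

(* law q sigma n s is the law of the history (s_1, a_1, ..., a_n, s_{n+1}) of
   the process started at s_1 = s. *)
Fixpoint law (q : R.-pker (S * A) ~> S) (sigma : policy) (n : nat) :
    R.-pker S ~> hist n :=
  match n with
  | 0 => kdirac (@measurable_id _ S setT)
  | m.+1 => kdprod (law q sigma m)
              (kpre (@measurable_snd _ _ S (hist m)) (step q sigma m))
  end.

End plays.

Record product_game (R : realType) := ProductGame {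
  state1 : pfinType;
  state2 : pfinType;
  action1 : pmetricType R;
  action2 : pmetricType R;
  compact_action1 : compact [set: action1];
  compact_action2 : compact [set: action2];
  (* A kernel is a measurable map into probability measures; here measurability
     is no extra condition, being implied by the continuity required below. *)
  trans1 : R.-pker (disc state1 * borel action1) ~> disc state1;
  trans2 : R.-pker (disc state2 * borel action2) ~> disc state2;
  trans1_continuous : forall x x' : state1,
    continuous (fun a : action1 => fine (trans1 (x, a) [set x']));
  trans2_continuous : forall y y' : state2,
    continuous (fun b : action2 => fine (trans2 (y, b) [set y']));
  payoff : state1 -> state2 -> action1 -> action2 -> R;
  payoff_ge0 : forall x y a b, 0 <= payoff x y a b;
  payoff_le1 : forall x y a b, payoff x y a b <= 1;
  payoff_continuous1 : forall x y b, continuous (fun a => payoff x y a b);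
  payoff_continuous2 : forall x y a, continuous (fun b => payoff x y a b)
}.

(* The state of stage T is the current state of a history of index T.-1. *)
Definition weakly_communicating (R : realType) (S : pfinType)
    (D : pmetricType R) (r : R.-pker (disc S * borel D) ~> disc S) : Prop :=
  exists (T : nat) (sigma : policy R (disc S) (borel D)), (1 <= T)%N /\
    forall s s' : S,
      (0 < law r sigma T.-1 s
             [set h : hist (disc S) (borel D) T.-1 | cur h = s'])%E.

Definition is_value (R : realType) (S1 S2 : Type) (g : S1 -> S2 -> R) (v : R) :
    Prop :=
  ereal_sup (range (fun s => ereal_inf (range (fun t => (g s t)%:E)))) = v%:E /\
  ereal_inf (range (fun t => ereal_sup (range (fun s => (g s t)%:E)))) = v%:E.

Section game.
Context (R : realType) (G : product_game R).

Local Notation X := (disc (state1 G)).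
Local Notation Y := (disc (state2 G)).
Local Notation A := (borel (action1 G)).
Local Notation B := (borel (action2 G)).

Definition strategy1 :=
  forall n, R.-pker (hist (X * Y)%type (A * B)%type n) ~> A.
Definition strategy2 :=
  forall n, R.-pker (hist (X * Y)%type (A * B)%type n) ~> B.

Lemma measurable_side1 : measurable_fun [set: (X * Y) * (A * B)]
  (fun z : (X * Y) * (A * B) => (z.1.1, z.2.1)).
Proof.
apply: measurable_fun_pair.
  exact: (measurableT_comp measurable_fst measurable_fst).
exact: (measurableT_comp measurable_fst measurable_snd).
Qed.

Lemma measurable_side2 : measurable_fun [set: (X * Y) * (A * B)]
  (fun z : (X * Y) * (A * B) => (z.1.2, z.2.2)).
Proof.
apply: measurable_fun_pair.
  exact: (measurableT_comp measurable_snd measurable_fst).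
exact: (measurableT_comp measurable_snd measurable_snd).
Qed.

Definition joint_trans :
    R.-pker ((X * Y) * (A * B)) ~> (X * Y)%type :=
  kindep (kpre measurable_side1 (trans1 G)) (kpre measurable_side2 (trans2 G)).

Definition joint_policy (sigma : strategy1) (tau : strategy2) :
    policy R (X * Y)%type (A * B)%type :=
  fun n => kindep (sigma n) (tau n).

(* Expected payoff of stage n.+1, which depends on the play only through
   (h_{n+1}, a_{n+1}, b_{n+1}), part of a history of index n.+1. *)
Definition expected_payoff (z : state1 G * state2 G)
    (sigma : strategy1) (tau : strategy2) (n : nat) : R :=
  \int[law joint_trans (joint_policy sigma tau) n.+1 z]_h
    payoff (cur h.1).1 (cur h.1).2 h.2.1.1 h.2.1.2.

Definition payoffN (N : nat) z sigma tau : R :=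
  N%:R^-1 * \sum_(n < N) expected_payoff z sigma tau n.

Definition payoffL (lambda : R) z sigma tau : R :=
  lambda * limn (series (fun n =>
    (1 - lambda) ^+ n * expected_payoff z sigma tau n)).

(* Stated separately so that the failure of has_asymptotic_value cannot come from
   some finite or discounted game having no value. *)
Definition values_exist : Prop :=
  (forall N z, (1 <= N)%N -> exists v, is_value (payoffN N z) v) /\
  (forall (lambda : R) z, 0 < lambda <= 1 -> exists v, is_value (payoffL lambda z) v).

Definition has_asymptotic_value : Prop :=
  exists (vN : nat -> state1 G * state2 G -> R)
         (vL : R -> state1 G * state2 G -> R) (v : state1 G * state2 G -> R),
    [/\ forall N z, (1 <= N)%N -> is_value (payoffN N z) (vN N z),
        forall (lambda : R) z, 0 < lambda <= 1 ->
          is_value (payoffL lambda z) (vL lambda z),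
        forall z, vN N z @[N --> \oo] --> v z &
        forall z, vL lambda z @[lambda --> 0^'+] --> v z].

End game.

(* Main.v *)
Require Import Defs.
From HB Require Import structures.
From mathcomp Require Import all_boot all_order all_algebra.
From mathcomp Require Import all_classical all_reals all_analysis.
From mathcomp Require Import measurable_realfun ring lra.

Set Implicit Arguments.
Unset Strict Implicit.
Unset Printing Implicit Defensive.

Import Order.TTheory GRing.Theory Num.Theory.
Import numFieldNormedType.Exports.

Local Open Scope classical_set_scope.
Local Open Scope ring_scope.

(** Each player moves a token on bool * Z/5.  An action has a rate r in [0, 1]:
    the token stays with probability 1 - r, its bit flips with probability
    r (1 - r), and it moves one step forward with probability r^2.  Rates
    strictly between 0 and 1 lead from every site to every site, so both sides
    are weakly communicating.  The payoff depends on the lead d in Z/5 of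
    player 2 over player 1, and on the bits: it is 1 if d is 1 or 2, it is 0 if
    d is 3 or 4, and at d = 0 it is 1 exactly when the bits differ.

    A token that gets ahead is lost.  A follower at distance 1 that stays and a
    follower at distance 2 that steps surely (rate 1) remains at distance 1 or 2
    whatever the leader does, and collects the best payoff for ever.  Hence
    stepping ahead alone acts like absorption in the worst payoff, although no
    site is absorbing for its owner.

    At d = 0 player 1 wants the bits to differ and player 2 wants them to agree.
    The player who is content waits (rate 0): this is dominant, by
    even_mean_ge and odd_mean_le.  The other one flips at some rate r; per flip,
    the delay costs lam / r and the risk of stepping ahead costs r, where lam is
    the discount rate.  The total r + lam / r is smallest at r = sqrt lam.  If
    c1 and c2 are the costs of the two players, the value v at d = 0 balances
    v c1 = (1 - v) c2.

    The rates of player 1 are the powers 16^-n, those of player 2 are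
    4 * 16^-n, together with 0 and 1.  For lam = 16^-(2 n) player 1 has the
    optimal rate available and player 2 misses it by a factor 4, which makes
    c2 / c1 close to (4 + 1/4) / 2 and v close to 17/25.  For
    lam = (4 * 16^-n)^2 the roles are exchanged and v is close to 8/25.  So the
    discounted values oscillate; value_ge_three_fifths and
    value_le_two_fifths certify this with stationary strategies and explicit
    sub- and super-solutions of the dynamic programming inequalities.

    Values exist because every one-shot game has a pure saddle point: backward
    induction (saddle_point) gives optimal pure strategies of every finite game
    with nonnegative stage weights, and discounted games are limits of those.
    The passage from inequalities between potentials to guarantees against all
    behavior strategies is guarantee1 and guarantee2.  All spaces of histories
    are countable with measurable points, which removes every measurability
    question. *)

(** * Integration against products of kernels *)

Section kdprod_integral.
Context (R : realType) d0 d1 d2 (T0 : measurableType d0)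
  (T1 : measurableType d1) (T2 : measurableType d2).
Variables (k1 : R.-pker T0 ~> T1) (k2 : R.-pker (T0 * T1) ~> T2).

Let graph_pair (p : T0 * T1 * T2) := (p.1.2, p.2).

Let measurable_graph_pair : measurable_fun setT graph_pair.
Proof.
apply: measurable_fun_pair; last exact: measurable_snd.
exact: (measurableT_comp measurable_snd measurable_fst).
Qed.

(* The law of (y, z) given (t, y): it turns kdprod into a composition of kernels,
   for which an integration formula is known. *)
Let graph_kernel : R.-sfker (T0 * T1) ~> (T1 * T2)%type :=
  mkcomp k2 (kdirac measurable_graph_pair).

Lemma ge0_integral_kdprod t (f : T1 * T2 -> \bar R) :
  measurable_fun setT f -> (forall z, 0 <= f z)%E ->
  (\int[kdprod k1 k2 t]_z f z = \int[k1 t]_y \int[k2 (t, y)]_x f (y, x))%E.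
Proof.
move=> mf f0.
transitivity (\int[kcomp k1 graph_kernel t]_z f z)%E.
  apply: eq_measure_integral => A mA _; rewrite /kcomp.
  apply: eq_integral => y _ /=.
  by apply: eq_integral => z _ /=; rewrite diracE indicE.
rewrite integral_kcomp //; apply: eq_integral => y _.
rewrite integral_kcomp //; apply: eq_integral => z _.
by rewrite integral_dirac // diracT mul1e.
Qed.

End kdprod_integral.

(** * Countable measurable spaces *)
Section countable_spaces.

(** Stable under products, so that it passes to spaces of histories, and enough
    to make every set and every function measurable. *)
Definition discrete_space d (T : measurableType d) :=
  countable [set: T] /\ forall t : T, measurable [set t].

Lemma discrete_measurable_set d (T : measurableType d) (A : set T) :
  discrete_space T -> measurable A.
Proof.
move=> [cT mT]; apply: countable_measurable => //.
exact: sub_countable (subset_card_le (@subsetT _ A)) cT.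
Qed.

Lemma discrete_measurable_fun d d' (T : measurableType d) (T' : measurableType d')
  (D : set T) (f : T -> T') : discrete_space T -> measurable_fun D f.
Proof. by move=> dT mD A mA; exact: discrete_measurable_set. Qed.

Lemma discrete_prod d d' (T : measurableType d) (T' : measurableType d') :
  discrete_space T -> discrete_space T' -> discrete_space (T * T')%type.
Proof.
move=> [cT mT] [cT' mT']; split.
  by rewrite -setXTT; exact: countableX.
move=> [t t']; rewrite (_ : [set (t, t')] = [set t] `*` [set t']).
  exact: measurableX.
by apply/seteqP; split => [_ ->|[x y] /= [-> ->]].
Qed.

Lemma discrete_hist dS dA (S : measurableType dS) (A : measurableType dA) n :
  discrete_space S -> discrete_space A -> discrete_space (hist S A n).
Proof.
move=> dS' dA'; elim: n => //= n IH.
by apply: discrete_prod => //; exact: discrete_prod.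
Qed.

Lemma discrete_disc (X : pfinType) : discrete_space (disc X).
Proof.
split; last by move=> t; exact: sub_sigma_algebra.
exact: (@countableP X).
Qed.

Lemma discrete_borel (R : realType) (A : pmetricType R) :
  countable [set: A] -> discrete_space (borel A).
Proof.
move=> cA; split => // t.
rewrite -[X in measurable X]setCK; apply: measurableC; apply: sub_sigma_algebra.
apply: closed_openC; apply: accessible_closed_set1; apply: hausdorff_accessible.
exact: (@metric_hausdorff R A).
Qed.

End countable_spaces.

(** * Laws of histories *)
Section law_integral.
Context (R : realType) dS dA (S : measurableType dS) (A : measurableType dA).
Hypotheses (discS : discrete_space S) (discA : discrete_space A).

Lemma ge0_integral_law (q : R.-pker (S * A) ~> S) (sigma : policy R S A) n s
    (f : hist S A n.+1 -> \bar R) : (forall h, 0 <= f h)%E ->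
  (\int[law q sigma n.+1 s]_h f h =
   \int[law q sigma n s]_h \int[sigma n h]_a
     \int[q (cur h, a)]_t f (h, (a, t)))%E.
Proof.
move=> f0.
have dAS : discrete_space (A * S)%type by exact: discrete_prod.
rewrite [LHS](_ : _ = \int[kdprod (law q sigma n)
    (kpre (@measurable_snd _ _ S (hist S A n)) (step q sigma n)) s]_h f h)%E //.
rewrite ge0_integral_kdprod //; last first.
  by apply: discrete_measurable_fun; apply: discrete_prod => //; exact: discrete_hist.
apply: eq_integral => h _.
rewrite [LHS](_ : _ = \int[kdprod (sigma n)
    (kpre (@measurable_cur_act _ _ S A n) q) h]_x f (h, x))%E //.
by rewrite ge0_integral_kdprod //; exact: discrete_measurable_fun.
Qed.

End law_integral.

Lemma ge0_integral_kindep (R : realType) d0 d1 d2 (T0 : measurableType d0)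
    (T1 : measurableType d1) (T2 : measurableType d2)
    (k1 : R.-pker T0 ~> T1) (k2 : R.-pker T0 ~> T2) t (f : T1 * T2 -> \bar R) :
  measurable_fun setT f -> (forall z, 0 <= f z)%E ->
  (\int[kindep k1 k2 t]_z f z = \int[k1 t]_y \int[k2 t]_x f (y, x))%E.
Proof. by move=> mf f0; rewrite /kindep ge0_integral_kdprod. Qed.

(** * The rates of the two players and the space of actions *)
Section actions.
Variable R : realType.

(** One index set serves both players: None is the limit point, of rate 0. *)
Definition grid := option nat.

(** The bool c names the player, false for player 1 and true for player 2.  The
    factor 4 puts each grid of rates, apart from the common rates 0 and 1, at the
    geometric middle of the gaps of the other one. *)
Definition phase (c : bool) : R := if c then 4 else 1.

Definition rate (c : bool) (a : grid) : R :=
  match a with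
  | None => 0
  | Some 0 => 1
  | Some n.+1 => phase c / 16 ^+ n.+1
  end.

Lemma rateS_le c n : rate c (Some n.+1) <= rate c (Some n) / 4.
Proof.
case: n => [|n] /=; first by rewrite /phase expr1; case: c; lra.
have x0 : (0 : R) < 16 ^- n.+1 by rewrite invr_gt0 exprn_gt0 //; lra.
rewrite exprS invfM /phase; case: c; lra.
Qed.

Lemma rate_gt0 c n : 0 < rate c (Some n).
Proof. by case: n => [|n] //=; rewrite divr_gt0 ?exprn_gt0 // /phase; case: c. Qed.

Lemma rate_ge0 c a : 0 <= rate c a.
Proof. by case: a => [n|] //; exact/ltW/rate_gt0. Qed.

Lemma rate_le_quarter c m n : (m < n)%N -> rate c (Some n) <= rate c (Some m) / 4.
Proof.
elim: n => // n IH; rewrite ltnS leq_eqVlt => /predU1P[->|/IH H].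
  exact: rateS_le.
have := rateS_le c n; have := rate_gt0 c n; have := rate_gt0 c m; lra.
Qed.

Lemma rate_le1 c a : rate c a <= 1.
Proof.
case: a => [[|n]|] //=; try lra.
have := @rate_le_quarter c 0 n.+1 isT; rewrite /=; lra.
Qed.

(** The metric on actions is that of the rates of player 1; this bound makes the
    rates of player 2 continuous for it. *)
Lemma rate_lipschitz c (a b : grid) :
  `|rate c a - rate c b| <= 4 * `|rate false a - rate false b|.
Proof.
have P n : rate c (Some n) <= 4 * rate false (Some n).
  case: n => [|n]; first by rewrite /=; lra.
  have x0 : (0 : R) < 16 ^- n.+1 by rewrite invr_gt0 exprn_gt0 //; lra.
  by rewrite /= /phase; case: c; lra.
have Q n : rate false (Some n) <= rate c (Some n).
  case: n => [|n]; first by rewrite /=; lra.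
  have x0 : (0 : R) < 16 ^- n.+1 by rewrite invr_gt0 exprn_gt0 //; lra.
  by rewrite /= /phase; case: c {P}; lra.
have M m n : (m < n)%N -> `|rate c (Some m) - rate c (Some n)| <=
    4 * `|rate false (Some m) - rate false (Some n)|.
  move=> mn; have L := rate_le_quarter c mn; have L' := rate_le_quarter false mn.
  rewrite !ger0_norm; last 2 first.
  - have := rate_gt0 false m; lra.
  - have := rate_gt0 c m; lra.
  case: m mn L L' => [mn L L'|m mn L L'].
    have := rate_gt0 c n; rewrite /= in L L' *; have := Q n; lra.
  case: n mn L L' => // n mn L L'.
  have : (16 : R) ^- n.+1 <= 16 ^- m.+1.
    by rewrite lef_pV2 ?posrE ?exprn_gt0 // ler_eXn2l ?ltr1n //; exact: ltnW.
  by rewrite /= /phase; case: c {P Q} L L' => L L'; lra.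
case: a b => [m|] [n|].
- have [mn|nm|->] := ltngtP m n; last by rewrite !subrr normr0 mulr0.
    exact: M.
  by rewrite distrC [in leRHS]distrC; exact: M.
- by rewrite !subr0 !ger0_norm ?rate_ge0 // P.
- by rewrite !sub0r !normrN !ger0_norm ?rate_ge0 // P.
- by rewrite subrr normr0 mulr0.
Qed.

Lemma rate_inj : injective (rate false).
Proof.
have M m n : (m < n)%N -> rate false (Some m) <> rate false (Some n).
  by move=> /(rate_le_quarter false); have := rate_gt0 false m; lra.
case=> [m|] [n|] //.
- by case: (ltngtP m n) => [/M //|/M H E|-> //]; case: H.
- by have := rate_gt0 false m => /= + E; rewrite E ltxx.
- by have := rate_gt0 false n => /= + E; rewrite -E ltxx.
Qed.

Lemma rate_cvg0 (e : R) : 0 < e -> exists n, rate false (Some n) < e.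
Proof.
move=> e0; exists (Num.truncn (e^-1)).+1.
rewrite /= /phase div1r -[ltRHS]invrK ltf_pV2 ?posrE ?invr_gt0 ?exprn_gt0 //.
apply: lt_le_trans (truncnS_gt _) _.
by rewrite -natrX ler_nat; apply: ltnW; apply: ltn_expl.
Qed.

End actions.
Arguments rate : simpl never.

Definition action (R : realType) : Type := grid.
HB.instance Definition _ R := Choice.on (action R).
HB.instance Definition _ R := isPointed.Build (action R) None.

Section action_metric.
Variable R : realType.
Let dist (a b : action R) := `|rate R false a - rate R false b|.
Let dist0 a : dist a a = 0. Proof. by rewrite /dist subrr normr0. Qed.
Let dist_pos a b : dist a b = 0 -> a = b.
Proof. by move/eqP; rewrite normr_eq0 subr_eq0 => /eqP/rate_inj. Qed.
Let dist_sym a b : dist a b = dist b a. Proof. exact: distrC. Qed.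
Let dist_tri b a c : dist a c <= dist a b + dist b c.
Proof. exact: ler_distD. Qed.
HB.instance Definition _ :=
  isMetric.Build R (action R) dist0 dist_pos dist_sym dist_tri.
HB.instance Definition _ := PointedMetric.on (action R).
End action_metric.

Section action_topology.
Variable R : realType.

Lemma lipschitz_continuous (T : metricType R) (f : T -> R) (k : R) :
  0 < k -> (forall x y, `|f x - f y| <= k * mdist x y) -> continuous f.
Proof.
move=> k0 fk x; apply/cvgrPdist_lt => e e0.
apply/nbhs_ballP; exists (e / k); first by rewrite /= divr_gt0.
rewrite ballEmdist => y /= H.
apply: le_lt_trans (fk _ _) _.
by rewrite -ltr_pdivlMl // mulrC.
Qed.

Lemma rate_continuous c : continuous (rate R c : action R -> R).
Proof.
apply: (@lipschitz_continuous (action R) _ 4) => //.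
exact: rate_lipschitz.
Qed.

(** A filter that does not cluster at None lives on finitely many actions. *)
Lemma compact_action : compact [set: action R].
Proof.
move=> F PF _.
have [cl|] := pselect (cluster F (None : action R)); first by exists None.
move=> /existsNP[A] /existsNP[B] /not_implyP[FA] /not_implyP[].
rewrite -nbhs_ballE => -[e /= e0] eB AB.
have [n rn] := rate_cvg0 e0.
pose S := [set (Some (i : nat) : action R) | i in `I_n].
have FS : F S.
  apply: filterS FA => -[m|] Am; last first.
    by case: AB; exists None; split => //; apply: eB; exact: ballxx.
  rewrite /S /=; have [mn|nm] := ltnP m n; first by exists m.
  case: AB; exists (Some m); split => //; apply: eB; rewrite ballEmdist /=.
  rewrite /mdist /= distrC subr0 ger0_norm ?rate_ge0 //.
  apply: le_lt_trans rn; move: nm; rewrite leq_eqVlt => /predU1P[-> //|].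
  by move=> /(rate_le_quarter R false); have := rate_gt0 R false n; lra.
have cS : compact S by apply: finite_compact; apply: finite_image; exact: finite_II.
by have [p [_ cp]] := cS F PF FS; exists p.
Qed.
End action_topology.

(** * The game *)
Definition site : Type := bool * 'I_5.
HB.instance Definition _ := Finite.on site.
HB.instance Definition _ := isPointed.Build site (false, ord0).
HB.instance Definition _ := PointedFinite.on site.

(** The three possible moves of a token, numbered 0, 1, 2 as in weight. *)
Definition dest (s : site) (i : nat) : site :=
  match i with
  | 0 => s
  | 1 => (~~ s.1, s.2)
  | _ => (s.1, s.2 + 1)
  end.

Section transition.
Variable R : realType.

Definition weight (r : R) (i : nat) : R :=
  match i with 0 => 1 - r | 1 => r * (1 - r) | _ => r ^+ 2 end.

Lemma weight_ge0 c (a : grid) i : 0 <= weight (rate R c a) i.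
Proof.
have := rate_ge0 R c a; have := rate_le1 R c a.
by case: i => [|[|i]] /= *; [lra|nra|nra].
Qed.

Lemma weight_sum (r : R) : \sum_(i < 3) weight r i = 1.
Proof. by rewrite !big_ord_recl big_ord0 /=; ring. Qed.

Definition trans (c : bool) (z : disc site * borel (action R)) :
    {measure set (disc site) -> \bar R} :=
  msum (fun i => mscale (NngNum (weight_ge0 c z.2 i))
                   (dirac (dest z.1 i : disc site))) 3.

Lemma transE c z U :
  trans c z U = (\sum_(i < 3) weight (rate R c z.2) i * \1_U (dest z.1 i))%:E.
Proof.
rewrite /trans /msum -sumEFin; apply: eq_bigr => i _.
by rewrite EFinM.
Qed.

Lemma discrete_action : discrete_space (borel (action R)).
Proof. by apply: discrete_borel; exact: (@countableP (option nat)). Qed.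

Let measurable_trans c U : measurable U ->
  measurable_fun [set: disc site * borel (action R)] (trans c ^~ U).
Proof.
move=> _; apply: discrete_measurable_fun; apply: discrete_prod.
  exact: discrete_disc.
exact: discrete_action.
Qed.

HB.instance Definition _ c :=
  isKernel.Build _ _ _ _ R (trans c) (@measurable_trans c).

Let trans_setT c z : trans c z setT = 1%E.
Proof.
rewrite transE -(weight_sum (rate R c z.2)).
by congr (_%:E); apply: eq_bigr => i _; rewrite indicE in_setT mulr1.
Qed.

HB.instance Definition _ c :=
  Kernel_isProbability.Build _ _ _ _ R (trans c) (trans_setT c).

Lemma integral_trans c z (f : site -> R) : (forall s, 0 <= f s) ->
  (\int[trans c z]_s (f s)%:E)%E =
  (\sum_(i < 3) weight (rate R c z.2) i * f (dest z.1 i))%:E.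
Proof.
move=> f0.
have mf : measurable_fun [set: disc site] (EFin \o f : disc site -> \bar R).
  by apply: discrete_measurable_fun; exact: discrete_disc.
rewrite /trans ge0_integral_measure_sum //; last by move=> s _; rewrite lee_fin.
rewrite -sumEFin; apply: eq_bigr => i _.
rewrite ge0_integral_mscale //; last by move=> s _; rewrite lee_fin.
by rewrite integral_dirac // diracT mul1e -EFinM.
Qed.

Lemma continuous_weight (T : topologicalType) (f : T -> R) (k : nat -> R) :
  continuous f -> continuous (fun t => \sum_(i < 3) weight (f t) i * k i).
Proof.
move=> cf t; rewrite (_ : (fun t => _) = (fun t =>
   (1 - f t) * k 0%N + f t * (1 - f t) * k 1%N + f t * f t * k 2%N)); last first.
  by apply/funext => b; rewrite !big_ord_recl big_ord0 /= addr0 addrA expr2.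
have c1 : (1 - f x) @[x --> t] --> 1 - f t.
  by apply: cvgB; [exact: cvg_cst|exact: cf].
have cft := cf t.
apply: cvgD; [apply: cvgD|].
- by apply: cvgM => //; exact: cvg_cst.
- by apply: cvgM; [exact: cvgM|exact: cvg_cst].
- by apply: cvgM; [exact: cvgM|exact: cvg_cst].
Qed.

Lemma trans_continuous c (x x' : site) :
  continuous (fun a : action R => fine (trans c (x, a) [set x'])).
Proof.
rewrite (_ : (fun a => _) = fun a =>
  \sum_(i < 3) weight (rate R c a) i * \1_[set x'] (dest x i)); last first.
  by apply/funext => a; rewrite transE.
apply: (@continuous_weight (action R) (rate R c) (fun i => \1_[set x'] (dest x i))).
exact: rate_continuous.
Qed.

(** Here d stands for the lead of player 2 and b for the difference of the bits.
    The payoff and the value functions of all finite and discounted games have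
    this form, which leaves the parameters c, e and w to determine. *)
Definition level (c e w : R) (b : bool) (d : 'I_5) : R :=
  match val d with
  | 0 => if b then w else e
  | 1 | 2 => c
  | _ => 0
  end.

Definition pot (c e w : R) (z : site * site) : R :=
  level c e w (z.1.1 (+) z.2.1) (z.2.2 - z.1.2).

Lemma level_bounds c e w b d : 0 <= e -> e <= w -> w <= c -> 0 <= level c e w b d <= c.
Proof.
move=> e0 ew wc; apply/andP.
by case: d => [[|[|[|[|[|?]]]]] ?] //; rewrite /level /=; case: b => /=; split; lra.
Qed.

Lemma pot_bounds c e w z : 0 <= e -> e <= w -> w <= c -> 0 <= pot c e w z <= c.
Proof. exact: level_bounds. Qed.

Definition gain : site * site -> R := pot 1 0 1.

Lemma gain_bounds z : 0 <= gain z <= 1.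
Proof. by apply: pot_bounds; lra. Qed.

Let gain_continuous z : continuous (fun _ : action R => gain z).
Proof. exact: (@cst_continuous (action R) R). Qed.

Definition game : product_game R :=
  @ProductGame R site site (action R) (action R)
    (@compact_action R) (@compact_action R) (trans false) (trans true)
    (@trans_continuous false) (@trans_continuous true)
    (fun x y _ _ => gain (x, y))
    (fun x y _ _ => proj1 (andP (gain_bounds (x, y))))
    (fun x y _ _ => proj2 (andP (gain_bounds (x, y))))
    (fun x y _ => @gain_continuous (x, y)) (fun x y _ => @gain_continuous (x, y)).

End transition.

(** * Expectations along a play *)
Section expectation.
Variable R : realType.
Local Notation G := (game R).
Local Notation S := (disc site).
Local Notation A := (borel (action R)).
Local Notation H n := (hist (S * S)%type (A * A)%type n).

Let discrete_action := discrete_action R.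
Let discrete_state : discrete_space (S * S)%type.
Proof. by apply: discrete_prod; exact: discrete_disc. Qed.
Let discrete_history n : discrete_space (H n).
Proof. by apply: discrete_hist => //; exact: discrete_prod. Qed.

Definition mean (a b : grid) (F : site * site -> R) (z : site * site) : R :=
  \sum_(i < 3) weight (rate R false a) i *
   (\sum_(j < 3) weight (rate R true b) j * F (dest z.1 i, dest z.2 j)).

Lemma mean_ge0 a b F z : (forall s, 0 <= F s) -> 0 <= mean a b F z.
Proof.
move=> F0; apply: sumr_ge0 => i _; apply: mulr_ge0; first exact: weight_ge0.
by apply: sumr_ge0 => j _; apply: mulr_ge0 => //; exact: weight_ge0.
Qed.

Lemma integral_joint_trans (z : S * S) (ab : A * A) F : (forall s, 0 <= F s) ->
  (\int[joint_trans G (z, ab)]_s (F s)%:E = (mean ab.1 ab.2 F z)%:E)%E.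
Proof.
move=> F0; rewrite /joint_trans ge0_integral_kindep; last 2 first.
- exact: discrete_measurable_fun.
- by move=> s; rewrite lee_fin.
transitivity (\int[trans false (z.1, ab.1)]_x
   (\sum_(j < 3) weight (rate R true ab.2) j * F (x, dest z.2 j))%:E)%E.
  apply: eq_integral => x _.
  exact: (@integral_trans R true (z.2, ab.2) (fun y => F (x, y))).
rewrite integral_trans // => s; apply: sumr_ge0 => j _.
by apply: mulr_ge0 => //; exact: weight_ge0.
Qed.

Variables (sigma : strategy1 G) (tau : strategy2 G) (z : site * site).

Definition expect n (F : site * site -> R) : \bar R :=
  \int[law (joint_trans G) (joint_policy sigma tau) n z]_h (F (cur h))%:E.

Lemma expect0 F : expect 0 F = (F z)%:E.
Proof.
rewrite /expect /= integral_dirac //; last exact: discrete_measurable_fun.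
by rewrite diracT mul1e.
Qed.

Lemma ge0_integral_joint_law n (f : H n.+1 -> \bar R) : (forall h, 0 <= f h)%E ->
  (\int[law (joint_trans G) (joint_policy sigma tau) n.+1 z]_h f h =
   \int[law (joint_trans G) (joint_policy sigma tau) n z]_h
   \int[sigma n h]_a \int[tau n h]_b
   \int[joint_trans G (cur h, (a, b))]_s f (h, ((a, b), s)))%E.
Proof.
move=> f0; have dA := discrete_prod discrete_action discrete_action.
rewrite ge0_integral_law //; apply: eq_integral => h _.
rewrite /joint_policy ge0_integral_kindep //; first exact: discrete_measurable_fun.
by move=> ab; exact: integral_ge0.
Qed.

Lemma expectS n F : (forall s, 0 <= F s) ->
  (expect n.+1 F = \int[law (joint_trans G) (joint_policy sigma tau) n z]_h
   \int[sigma n h]_a \int[tau n h]_b (mean a b F (cur h))%:E)%E.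
Proof.
move=> F0; rewrite /expect ge0_integral_joint_law; last by move=> h; rewrite lee_fin.
apply: eq_integral => h _; apply: eq_integral => a _; apply: eq_integral => b _.
exact: (@integral_joint_trans (cur h) (a, b) F).
Qed.

End expectation.

(** * Weak communication *)
Section communication.
Variables (R : realType) (c : bool).
Local Notation S := (disc site).
Local Notation A := (borel (action R)).
Local Notation H n := (hist S A n).

Let discrete_action := discrete_action R.
Let discrete_history n : discrete_space (H n).
Proof. by apply: discrete_hist => //; exact: discrete_disc. Qed.

(* Some 1 has a rate strictly between 0 and 1 for both players, so that each of
   the three moves has positive probability. *)
Let roam : policy R S A := fun n => kdirac (@measurable_cst _ _ (H n) A setT (Some 1%N)).

Let reach n (s t : site) : \bar R :=
  law (trans c) roam n s [set h : H n | cur h = t].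

Let weight_gt0 i : 0 < weight (rate R c (Some 1%N)) i.
Proof.
have rE : rate R c (Some 1%N) = phase R c / 16 by rewrite /rate expr1.
by case: i => [|[|i]] /=; rewrite rE /phase; case: c; lra.
Qed.

Let reach0 s : (0 < reach 0 s s)%E.
Proof. by rewrite /reach /= diracE mem_set // lte_fin. Qed.

Let reachS n s t i : (0 < reach n s t)%E -> (0 < reach n.+1 s (dest t i))%E.
Proof.
have [j ->] : exists j : 'I_3, dest t i = dest t j.
  case: i => [|[|i]].
  - by exists (inord 0); rewrite inordK.
  - by exists (inord 1); rewrite inordK.
  - by exists (inord 2); rewrite inordK.
move=> Pt; set r := rate R c (Some 1%N).
apply: (@lt_le_trans _ _ ((weight r j)%:E * reach n s t)%E).
  by rewrite mule_gt0 // lte_fin.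
have mS m (B : set (H m)) : measurable B by exact: discrete_measurable_set.
have reachE m u : reach m s u =
    (\int[law (trans c) roam m s]_h (\1_[set u] (cur h))%:E)%E.
  by rewrite /reach -[X in law _ _ m _ X]setIT -integral_indic.
rewrite !reachE ge0_integral_law //; last exact: discrete_disc.
rewrite -ge0_integralZl //; last by rewrite lee_fin ltW.
apply: ge0_le_integral => //; try exact: discrete_measurable_fun.
  by move=> h _; rewrite -EFinM lee_fin mulr_ge0 // ltW.
move=> h _; rewrite /roam /kdirac integral_dirac //; last exact: discrete_measurable_fun.
rewrite diracT mul1e /=.
have [ht|ht] := eqVneq (cur h) t; last first.
  rewrite [\1_[set t] _]indicE memNset ?mule0; last by move=> /= E; rewrite E eqxx in ht.
  by apply: integral_ge0 => u _; rewrite lee_fin.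
rewrite (@integral_trans R c (cur h, Some 1%N) \1_[set dest t j]) // -EFinM lee_fin.
rewrite ht [\1_[set t] t]indicE mem_set // mulr1 (bigD1 j) //=.
rewrite indicE mem_set // mulr1 lerDl; apply: sumr_ge0 => k _.
by rewrite mulr_ge0 // ltW.
Qed.

(** Five moves suffice: one to set the bit, then four that step or stay, since at
    most four steps are needed in Z/5. *)
Lemma trans_weakly_communicating : weakly_communicating (trans c : R.-pker _ ~> _).
Proof.
exists 6%N, roam; split => // s s'; rewrite -/(reach 5 s s').
case: s s' => [b k] [b' k'].
have start : (0 < reach 1 (b, k) (b', k))%E.
  have := reachS (if b == b' then 0 else 1) (reach0 (b, k)).
  by case: b; case: b'.
have walk m j : (j <= m)%N -> (0 < reach m.+1 (b, k) (b', k + j%:R)%R)%E.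
  elim: m j => [|m IH] j; first by rewrite leqn0 => /eqP ->; rewrite addr0.
  rewrite leq_eqVlt => /predU1P[->|jm].
    by have := reachS 2 (IH m (leqnn m)); rewrite /dest /= -addrA -mulrSr.
  exact: (reachS 0 (IH j jm)).
have := walk 4%N (k' - k) (leq_ord _).
by rewrite natr_Zp addrC subrK.
Qed.

End communication.


(** * Guarantees of pure Markov strategies *)
Section prob_kernel_bounds.
Context (R : realType) d d' (T : measurableType d) (T' : measurableType d').
Variables (k : R.-pker T ~> T') (t : T) (c : R).

Lemma integral_prob_cst : (\int[k t]_y c%:E = c%:E)%E.
Proof. by rewrite integral_cst // [X in (_ * X)%E]prob_kernel mule1. Qed.

Variable f : T' -> \bar R.
Hypothesis mf : measurable_fun setT f.

Lemma integral_prob_ge :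
  0 <= c -> (forall y, c%:E <= f y)%E -> (c%:E <= \int[k t]_y f y)%E.
Proof. by move=> c0 cf; rewrite -integral_prob_cst; exact: ge0_le_integral. Qed.

Lemma integral_prob_le : (forall y, 0 <= f y)%E -> (forall y, f y <= c%:E)%E ->
  (\int[k t]_y f y <= c%:E)%E.
Proof. by move=> f0 fc; rewrite -[leRHS]integral_prob_cst; apply: ge0_le_integral. Qed.

End prob_kernel_bounds.

Section play_bounds.
Variable R : realType.
Local Notation G := (game R).
Local Notation S := (disc site).
Local Notation A := (borel (action R)).
Local Notation H n := (hist (S * S)%type (A * A)%type n).

Let discrete_action := discrete_action R.
Let discrete_state : discrete_space (S * S)%type.
Proof. by apply: discrete_prod; exact: discrete_disc. Qed.
Let discrete_history n : discrete_space (H n).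
Proof. by apply: discrete_hist => //; exact: discrete_prod. Qed.

Section given_strategies.
Variables (sigma : strategy1 G) (tau : strategy2 G) (z : site * site).
Local Notation expect := (expect sigma tau z).

Lemma expect_ge0 n F : (forall s, 0 <= F s) -> (0 <= expect n F)%E.
Proof. by move=> F0; apply: integral_ge0 => h _; rewrite lee_fin. Qed.

Lemma expect_le n F (M : R) : (forall s, 0 <= F s <= M) -> (expect n F <= M%:E)%E.
Proof.
move=> FM; rewrite /expect; apply: integral_prob_le.
- exact: discrete_measurable_fun.
- by move=> h; rewrite lee_fin; case/andP: (FM (cur h)).
- by move=> h; rewrite lee_fin; case/andP: (FM (cur h)).
Qed.

Lemma expected_payoffE n :
  (expected_payoff (z : state1 G * state2 G) sigma tau n)%:E = expect n (@gain R).
Proof.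
rewrite /expected_payoff /Rintegral.
have gain0 s : 0 <= gain R s by case/andP: (gain_bounds R s).
have -> : (\int[law (joint_trans G) (joint_policy sigma tau) n.+1 z]_h
    (payoff (cur h.1).1 (cur h.1).2 h.2.1.1 h.2.1.2)%:E = expect n (@gain R))%E.
  rewrite ge0_integral_joint_law; last by move=> h; rewrite lee_fin; exact: gain0.
  apply: eq_integral => h _ /=.
  rewrite -[RHS](integral_prob_cst (sigma n) h); apply: eq_integral => a _.
  rewrite -[RHS](integral_prob_cst (tau n) h); apply: eq_integral => b _.
  exact: (integral_prob_cst (joint_trans G) (cur h, (a, b))).
rewrite fineK // ge0_fin_numE ?expect_ge0 //.
by apply: le_lt_trans (expect_le _ (@gain_bounds R)) _; rewrite ltry.
Qed.

Lemma expected_payoff_bounds n :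
  0 <= expected_payoff (z : state1 G * state2 G) sigma tau n <= 1.
Proof.
rewrite -!lee_fin expected_payoffE expect_ge0 /=.
  by apply: expect_le; exact: gain_bounds.
by move=> s; case/andP: (gain_bounds R s).
Qed.

Let next n F (h : H n) :=
  (\int[sigma n h]_a \int[tau n h]_b (mean a b F (cur h))%:E)%E.

Let next_ge0 n F (h : H n) : (forall s, 0 <= F s) -> (0 <= next F h)%E.
Proof.
by move=> F0; do 2 apply: integral_ge0 => ? _; rewrite lee_fin mean_ge0.
Qed.

Let expect_gainD n (th : R) F : 0 <= th -> (forall s, 0 <= F s) ->
  (th%:E * expect n (@gain R) + expect n.+1 F =
   \int[law (joint_trans G) (joint_policy sigma tau) n z]_h
   ((th * gain R (cur h))%:E + next F h))%E.
Proof.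
move=> th0 F0.
have gain0 s : 0 <= gain R s by case/andP: (gain_bounds R s).
have mf f : measurable_fun [set: H n] (f : H n -> \bar R).
  exact: discrete_measurable_fun.
rewrite expectS // -ge0_integralZl //; last first.
  by move=> h _; rewrite lee_fin.
rewrite -ge0_integralD //.
- by move=> h _; rewrite -EFinM lee_fin mulr_ge0.
- by move=> h _; exact: next_ge0.
Qed.

(** The hypothesis compares F before a stage with F' after it, against the mixed
    actions that the given strategies prescribe; averaging over histories is then
    a one-stage inequality of dynamic programming. *)
Lemma expect_step_le n (th : R) F F' : 0 <= th ->
  (forall s, 0 <= F s) -> (forall s, 0 <= F' s) ->
  (forall h : H n, (F (cur h))%:E <= (th * gain R (cur h))%:E + next F' h)%E ->
  (expect n F <= th%:E * expect n (@gain R) + expect n.+1 F')%E.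
Proof.
move=> th0 F0 F'0 FF'; rewrite expect_gainD //.
apply: ge0_le_integral => //; try exact: discrete_measurable_fun.
by move=> h _; rewrite lee_fin.
Qed.

Lemma expect_step_ge n (th : R) F F' : 0 <= th ->
  (forall s, 0 <= F s) -> (forall s, 0 <= F' s) ->
  (forall h : H n, (th * gain R (cur h))%:E + next F' h <= (F (cur h))%:E)%E ->
  (th%:E * expect n (@gain R) + expect n.+1 F' <= expect n F)%E.
Proof.
move=> th0 F0 F'0 FF'; rewrite expect_gainD //.
apply: ge0_le_integral => //; try exact: discrete_measurable_fun.
move=> h _; apply: adde_ge0; last exact: next_ge0.
by rewrite lee_fin mulr_ge0 //; case/andP: (gain_bounds R (cur h)).
Qed.

End given_strategies.

Let measurable_pure n (a : site * site -> grid) :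
  measurable_fun [set: H n] (fun h => a (cur h) : A).
Proof. exact: discrete_measurable_fun. Qed.

Definition pure1 (a : nat -> site * site -> grid) : strategy1 G :=
  fun n => kdirac (measurable_pure (a n)).

Definition pure2 (b : nat -> site * site -> grid) : strategy2 G :=
  fun n => kdirac (measurable_pure (b n)).

Lemma integral_pure n (a : site * site -> grid) (h : H n) (f : A -> \bar R) :
  (\int[kdirac (measurable_pure a) h]_x f x = f (a (cur h)))%E.
Proof.
rewrite /kdirac integral_dirac //; last exact: discrete_measurable_fun.
by rewrite diracT mul1e.
Qed.

Section guarantee.
Variables (N : nat) (th : nat -> R) (W : nat -> site * site -> R).
Hypotheses (th0 : forall n, 0 <= th n) (W0 : forall n z, 0 <= W n z).

(** If player 1 plays a n at stage n and W is a sub-solution, W n at the current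
    sites plus the weighted payoffs of the earlier stages is a submartingale,
    whatever player 2 does. *)
Lemma guarantee1 (a : nat -> site * site -> grid) (M : R) :
  (forall n z b, (n < N)%N ->
     W n z <= th n * gain R z + mean (a n z) b (W n.+1) z) ->
  (forall z, W N z <= M) ->
  forall tau z, W 0%N z <=
    \sum_(n < N) th n * expected_payoff (z : state1 G * state2 G) (pure1 a) tau n + M.
Proof.
move=> HW WM tau z; rewrite -lee_fin EFinD -sumEFin.
under eq_bigr do rewrite EFinM expected_payoffE.
apply: (@le_trans _ _ (\sum_(n < N) (th n)%:E * expect (pure1 a) tau z n (@gain R)
   + expect (pure1 a) tau z N (W N))%E); last first.
  by rewrite leeD2l // expect_le // => s; rewrite W0 WM.
elim: N HW {WM} => [|m IH] HW; first by rewrite big_ord0 add0e expect0.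
apply: le_trans (IH _) _; first by move=> n s b nm; apply: HW; exact: ltnW.
rewrite big_ord_recr /= -addeA leeD2l //; apply: expect_step_le => // h.
rewrite integral_pure -leeBlDl // -EFinB.
(* The bound to integrate over the actions of player 2 may be negative; then it
   holds trivially. *)
have [W0'|W0'] := leP 0 (W m (cur h) - th m * gain R (cur h)).
  apply: integral_prob_ge => //; first exact: discrete_measurable_fun.
  by move=> b; rewrite lee_fin lerBlDl; exact: HW.
apply: (@le_trans _ _ 0%E); first by rewrite lee_fin ltW.
by apply: integral_ge0 => b _; rewrite lee_fin mean_ge0.
Qed.

(** The supermartingale counterpart for player 2; the terminal term is dropped
    since it is nonnegative. *)
Lemma guarantee2 (b : nat -> site * site -> grid) :
  (forall n z a, (n < N)%N ->
     th n * gain R z + mean a (b n z) (W n.+1) z <= W n z) ->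
  forall sigma z,
    \sum_(n < N) th n * expected_payoff (z : state1 G * state2 G) sigma (pure2 b) n
    <= W 0%N z.
Proof.
move=> HW sigma z; rewrite -lee_fin -sumEFin.
under eq_bigr do rewrite EFinM expected_payoffE.
apply: (@le_trans _ _ (\sum_(n < N) (th n)%:E * expect sigma (pure2 b) z n (@gain R)
   + expect sigma (pure2 b) z N (W N))%E).
  by rewrite leeDl // expect_ge0.
elim: N HW => [|m IH] HW; first by rewrite big_ord0 add0e expect0.
apply: le_trans (IH _); last by move=> n s a nm; apply: HW; exact: ltnW.
rewrite big_ord_recr /= -addeA leeD2l //; apply: expect_step_ge => // h.
rewrite -leeBrDl // -EFinB.
under eq_integral do rewrite integral_pure.
apply: integral_prob_le => //.
- exact: discrete_measurable_fun.
- by move=> a; rewrite lee_fin mean_ge0.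
- by move=> a; rewrite lee_fin lerBrDl; exact: HW.
Qed.

End guarantee.
End play_bounds.

(** * One-shot games *)
Section level_mean.
Variable R : realType.
Implicit Types (r s c e w : R).

(** The mean of a potential depends on the pair of sites only through the lead d
    and the difference b of the bits, so finitely many cases remain. *)
Definition level_mean r s c e w (b : bool) (d : 'I_5) : R :=
  \sum_(i < 3) weight r i * (\sum_(j < 3) weight s j *
    level c e w (b (+) (val i == 1%N) (+) (val j == 1%N))
      (d + (val j == 2%N)%:R - (val i == 2%N)%:R)).

Lemma mean_pot (a b : grid) c e w z : mean a b (pot c e w) z =
  level_mean (rate R false a) (rate R true b) c e w (z.1.1 (+) z.2.1) (z.2.2 - z.1.2).
Proof.
apply: eq_bigr => i _; congr (_ * _); apply: eq_bigr => j _; congr (_ * _).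
rewrite /pot /=; congr level.
  by case: z => -[b1 k1] [b2 k2] /=; case: i => [[|[|[|//]]] ?] /=;
     case: j => [[|[|[|//]]] ?] /=; case: b1; case: b2.
by case: z => -[b1 k1] [b2 k2] /=; case: i => [[|[|[|//]]] ?] /=;
     case: j => [[|[|[|//]]] ?] /=; ring.
Qed.

(** even_mean and odd_mean are the values of level_mean at d = 0, when the bits
    agree and when they differ.  The first two terms come from steps forward:
    both players, or player 2 alone (player 1 alone yields 0). *)
Definition even_mean r s c e w : R :=
  r ^+ 2 * s ^+ 2 * e + (1 - r ^+ 2) * s ^+ 2 * c
  + (1 - r) * (1 - s) * ((1 + r * s) * e + (r + s) * w).

Definition odd_mean r s c e w : R :=
  r ^+ 2 * s ^+ 2 * w + (1 - r ^+ 2) * s ^+ 2 * c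
  + (1 - r) * (1 - s) * ((1 + r * s) * w + (r + s) * e).

Lemma level_meanE r s c e w b (d : 'I_5) : level_mean r s c e w b d =
  match val d with
  | 0 => if b then odd_mean r s c e w else even_mean r s c e w
  | 1 => (1 - r ^+ 2) * c + r ^+ 2 * s ^+ 2 * c +
         r ^+ 2 * ((1 - s) * (if b then w + s * e else e + s * w))
  | 2 => (1 - s ^+ 2) * c + r ^+ 2 * s ^+ 2 * c
  | 3 => r ^+ 2 * (1 - s ^+ 2) * c
  | _ => s ^+ 2 * ((1 - r) * (if b then w + r * e else e + r * w))
  end.
Proof.
rewrite /level_mean !big_ord_recl !big_ord0 /= /level.
by case: d => [[|[|[|[|[|?]]]]] ?] //; case: b => /=;
   rewrite /even_mean /odd_mean; ring.
Qed.

End level_mean.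

Section one_shot.
Variable R : realType.
Implicit Types (r s c e w : R).

(** When the bits agree, player 2 cannot do better than the rate s = 0: any
    activity of his may only help the bits to differ or put him ahead. *)
Lemma even_mean_ge r s c e w : 0 <= r <= 1 -> 0 <= s <= 1 ->
  0 <= e -> e <= w -> w <= c ->
  (1 - r) * e + r * (1 - r) * w <= even_mean r s c e w.
Proof.
move=> /andP[r0 r1] /andP[s0 s1] e0 ew wc; rewrite -subr_ge0 /even_mean.
rewrite (_ : _ - _ = r ^+ 2 * s ^+ 2 * e +
  s * (1 - r) * (s * (c - w) + s * r * (c - e) + (w - e) * (1 - r))); last by ring.
by repeat first [lra | apply: exprn_ge0 | apply: mulr_ge0 | apply: addr_ge0].
Qed.

(** The counterpart when the bits differ: activity of player 1 may only make them
    agree or put him ahead. *)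
Lemma odd_mean_le r s c e w : 0 <= r <= 1 -> 0 <= s <= 1 ->
  0 <= e -> e <= w -> w <= c ->
  odd_mean r s c e w <= (1 - s) * w + s * (1 - s) * e + s ^+ 2 * c.
Proof.
move=> /andP[r0 r1] /andP[s0 s1] e0 ew wc; rewrite -subr_ge0 /odd_mean.
rewrite (_ : _ - _ = r ^+ 2 * s ^+ 2 * (c - w) +
  r * (1 - s) * ((w - e) * (1 - s) + (w - e) * (r * s) + e * r + e * (r * s)));
  last by ring.
by repeat first [lra | apply: exprn_ge0 | apply: mulr_ge0 | apply: addr_ge0].
Qed.

(** Player 1 as a follower at distance 2 steps surely and at distance 1 stays; at
    d = 0 he flips with the action al when the bits agree, and waits otherwise. *)
Definition play1 (al : grid) (z : site * site) : grid :=
  match val (z.2.2 - z.1.2) with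
  | 0 => if z.1.1 (+) z.2.1 then None else al
  | 2 => Some 0%N
  | _ => None
  end.

(** The symmetric strategy; d = 3 in Z/5 means that player 1 is ahead by 2. *)
Definition play2 (be : grid) (z : site * site) : grid :=
  match val (z.2.2 - z.1.2) with
  | 0 => if z.1.1 (+) z.2.1 then be else None
  | 3 => Some 0%N
  | _ => None
  end.

Let rate01 b (a : grid) : 0 <= rate R b a <= 1.
Proof. by rewrite rate_ge0 rate_le1. Qed.

Variables (th c e w c' e' w' : R).
Hypotheses (e0 : 0 <= e') (ew : e' <= w') (wc : w' <= c').

(** The dynamic programming inequality for play1 reduces to one inequality in
    each state: the content player waits at d = 0, and a follower remains at
    distance 1 or 2 for ever. *)
Lemma pot_le_mean (al : grid) :
  0 <= th -> c <= th + c' ->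
  e <= (1 - rate R false al) * e' + rate R false al * (1 - rate R false al) * w' ->
  (forall b, w <= th + ((1 - rate R true b) * w' +
     rate R true b * (1 - rate R true b) * e' + rate R true b ^+ 2 * c')) ->
  forall z b, pot c e w z <= th * gain R z + mean (play1 al z) b (pot c' e' w') z.
Proof.
move=> th0 Hc He Hw z b; rewrite mean_pot level_meanE /gain /pot /level /play1.
have /andP[s0 s1] := rate01 true b.
case: (z.2.2 - z.1.2) => [[|[|[|[|[|?]]]]] ?] //=.
- case: (z.1.1 (+) z.2.1).
  + apply: le_trans (Hw b) _; rewrite mulr1 lerD2l /odd_mean /rate.
    by rewrite le_eqVlt; apply/orP; left; apply/eqP; ring.
  + rewrite mulr0 add0r; apply: le_trans He _.
    exact: even_mean_ge.
- rewrite mulr1 -[rate R false None]/0; lra.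
- rewrite mulr1 -[rate R false (Some 0%N)]/1; lra.
- by rewrite -[rate R false None]/0; lra.
- rewrite mulr0 add0r subr0 mul1r; apply: mulr_ge0; first exact: exprn_ge0.
  rewrite -[rate R false None]/0 !mul0r !addr0.
  by case: ifP => _ //; exact: le_trans ew.
Qed.

Lemma mean_le_pot (be : grid) :
  th + c' <= c ->
  (forall a, (1 - rate R false a) * e' + rate R false a * (1 - rate R false a) * w' <= e) ->
  th + ((1 - rate R true be) * w' +
     rate R true be * (1 - rate R true be) * e' + rate R true be ^+ 2 * c') <= w ->
  forall z a, th * gain R z + mean a (play2 be z) (pot c' e' w') z <= pot c e w z.
Proof.
move=> Hc He Hw z a; rewrite mean_pot level_meanE /gain /pot /level /play2.
have /andP[r0 r1] := rate01 false a.
have r2 : 0 <= rate R false a ^+ 2 by exact: exprn_ge0.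
have r3 : rate R false a ^+ 2 <= 1 by rewrite expr_le1.
case: (z.2.2 - z.1.2) => [[|[|[|[|[|?]]]]] ?] //=.
- case: (z.1.1 (+) z.2.1).
  + apply: le_trans Hw; rewrite mulr1 lerD2l; exact: odd_mean_le.
  + rewrite mulr0 add0r; apply: le_trans (He a).
    rewrite /even_mean -[rate R true None]/0.
    by rewrite le_eqVlt; apply/orP; left; apply/eqP; ring.
- rewrite mulr1 -[rate R true None]/0; apply: le_trans Hc.
  rewrite lerD2l expr0n /= mulr0 mul0r addr0 subr0 mul1r.
  have H1 : 0 <= rate R false a ^+ 2 * (c' - w') by rewrite mulr_ge0 // subr_ge0.
  have H2 : 0 <= rate R false a ^+ 2 * (c' - e').
    by rewrite mulr_ge0 // subr_ge0 (le_trans ew).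
  by case: ifP => _; rewrite mul0r addr0; lra.
- by rewrite mulr1 -[rate R true None]/0; lra.
- by rewrite mulr0 add0r -[rate R true (Some 0%N)]/1; lra.
- by rewrite mulr0 add0r -[rate R true None]/0; lra.
Qed.

End one_shot.

(** * Existence of values *)
Section value_of_a_game.
Context (R : realType) (S1 S2 : Type) (g : S1 -> S2 -> R).

Let lo := ereal_sup (range (fun s => ereal_inf (range (fun t => (g s t)%:E)))).
Let hi := ereal_inf (range (fun t => ereal_sup (range (fun s => (g s t)%:E)))).

Let lo_ge (c : R) s : (forall t, c <= g s t) -> (c%:E <= lo)%E.
Proof.
move=> cg; apply: le_trans (ereal_sup_ubound _); last by exists s.
by apply: le_ereal_inf_tmp => _ [t _ <-]; rewrite lee_fin.
Qed.

Let hi_le (c : R) t : (forall s, g s t <= c) -> (hi <= c%:E)%E.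
Proof.
move=> gc; apply: le_trans (ereal_inf_lbound _) _; first by exists t.
by apply: ge_ereal_sup => _ [s _ <-]; rewrite lee_fin.
Qed.

Let lo_le_hi : (lo <= hi)%E.
Proof.
apply: ge_ereal_sup => _ [s _ <-]; apply: le_ereal_inf_tmp => _ [t _ <-].
apply: (@le_trans _ _ (g s t)%:E).
  by apply: ereal_inf_lbound; exists t.
by apply: ereal_sup_ubound; exists s.
Qed.

Lemma is_value_ge v c s : is_value g v -> (forall t, c <= g s t) -> c <= v.
Proof. by move=> [lov _] /lo_ge; rewrite /lo lov lee_fin. Qed.

Lemma is_value_le v c t : is_value g v -> (forall s, g s t <= c) -> v <= c.
Proof. by move=> [_ hiv] /hi_le; rewrite /hi hiv lee_fin. Qed.

Lemma approx_saddle_is_value :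
  (forall eps : R, 0 < eps -> exists v s t,
     (forall t', v - eps <= g s t') /\ (forall s', g s' t <= v + eps)) ->
  exists v, is_value g v.
Proof.
move=> H; have [v1 [s1 [t1 [/lo_ge lo1 /hi_le hi1]]]] := H 1 ltr01.
have lof : lo \is a fin_num.
  rewrite fin_numE -ltNye -ltey; apply/andP; split.
    by apply: lt_le_trans lo1; rewrite ltNyr.
  by apply: le_lt_trans (le_trans lo_le_hi hi1) _; rewrite ltry.
exists (fine lo); rewrite /is_value -/lo -/hi fineK //; split => //.
apply/le_anti; rewrite lo_le_hi andbT.
apply/lee_addgt0Pr => e e0.
have e2 : 0 < e / 2 by rewrite divr_gt0.
have [v [s [t [/lo_ge lov /hi_le hiv]]]] := H _ e2.
apply: le_trans hiv _; rewrite -leeBlDr // -EFinB; apply: le_trans lov.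
by rewrite lee_fin; lra.
Qed.

End value_of_a_game.

Lemma geometric_small (R : realType) (q eps : R) : 0 <= q < 1 -> 0 < eps -> exists N, q ^+ N < eps.
Proof.
move=> /andP[q0 q1] eps0.
have : q ^+ n @[n --> \oo] --> 0 by apply: cvg_expr; rewrite ger0_norm.
move=> /cvgrPdist_lt /(_ _ eps0) [N _ /(_ N (leqnn N))] /=.
by rewrite sub0r normrN ger0_norm ?exprn_ge0 // => H; exists N.
Qed.

Section discounted_truncation.
Variables (R : realType) (lam : R) (f : nat -> R).
Hypotheses (lam_gt0 : 0 < lam) (lam_le1 : lam <= 1) (f01 : forall n, 0 <= f n <= 1).

Let s := series (fun n => (1 - lam) ^+ n * f n).
Let q0 : 0 <= 1 - lam. Proof. by rewrite subr_ge0. Qed.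

Let sS n : s n.+1 = s n + (1 - lam) ^+ n * f n.
Proof. by rewrite /s !seriesEnat /= big_nat_recr. Qed.

Let s_nd : nondecreasing_seq s.
Proof.
apply/nondecreasing_seqP => n; rewrite sS.
by rewrite lerDl mulr_ge0 ?exprn_ge0 //; case/andP: (f01 n).
Qed.

(* The weights lam (1 - lam)^i sum to (1 - lam)^N - (1 - lam)^(N + k) over the
   k stages that follow N. *)
Let s_tail N k : lam * s (N + k)%N <= lam * s N + (1 - lam) ^+ N - (1 - lam) ^+ (N + k).
Proof.
elim: k => [|k IH]; first by rewrite addn0 addrK.
rewrite addnS sS mulrDr.
have /andP[f0 f1] := f01 (N + k)%N.
have qk : 0 <= (1 - lam) ^+ (N + k) by exact: exprn_ge0.
have : lam * ((1 - lam) ^+ (N + k) * f (N + k)%N) <= lam * (1 - lam) ^+ (N + k).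
  by rewrite ler_pM2l // ler_piMr.
by move: IH; rewrite exprS; lra.
Qed.

Let s_le N M : lam * s M <= lam * s N + (1 - lam) ^+ N.
Proof.
apply: (@le_trans _ _ (lam * s (N + M)%N)).
  by rewrite ler_pM2l //; apply: s_nd; exact: leq_addl.
by apply: le_trans (s_tail N M) _; rewrite gerBl exprn_ge0.
Qed.

Let s_cvg : cvgn s.
Proof.
apply: nondecreasing_is_cvgn => //; exists (lam^-1) => _ [M _ <-].
rewrite -(ler_pM2l lam_gt0) divff ?gt_eqF //.
by have := s_le 0 M; rewrite {2}/s seriesEnat /= big_geq // mulr0 add0r expr0.
Qed.

Lemma discounted_ge N :
  \sum_(n < N) lam * (1 - lam) ^+ n * f n <= lam * limn s.
Proof.
under eq_bigr do rewrite -mulrA.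
rewrite -mulr_sumr ler_pM2l //.
rewrite (_ : \sum_(n < N) _ = s N); first exact: nondecreasing_cvgn_le.
by rewrite /s seriesEord.
Qed.

Lemma discounted_le N :
  lam * limn s <= \sum_(n < N) lam * (1 - lam) ^+ n * f n + (1 - lam) ^+ N.
Proof.
under eq_bigr do rewrite -mulrA.
rewrite -mulr_sumr (_ : \sum_(n < N) _ = s N); last by rewrite /s seriesEord.
rewrite -ler_pdivlMl //; apply: limr_le => //; near=> M.
by rewrite ler_pdivlMl.
Unshelve. all: by end_near. Qed.

End discounted_truncation.

Section dynamic_programming.
Variable R : realType.

Let mixed (b : bool) (k : nat -> R) (a : grid) : R :=
  \sum_(i < 3) weight (rate R b a) i * k i.

Let mixed_within b k : {within [set: action R], continuous (mixed b k : action R -> R)}.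
Proof.
apply: continuous_subspaceT; apply: (@continuous_weight R (action R) (rate R b)).
exact: rate_continuous.
Qed.

(** Attained because the space of actions is compact. *)
Lemma best_action1 (e w : R) : exists al : grid, forall a,
  (1 - rate R false a) * e + rate R false a * (1 - rate R false a) * w <=
  (1 - rate R false al) * e + rate R false al * (1 - rate R false al) * w.
Proof.
pose k i : R := match i with 0 => e | 1 => w | _ => 0 end.
have A0 : [set: action R] !=set0 by exists None.
have [al _ H] := compact_EVT_max A0 (@compact_action R) (@mixed_within false k).
exists al => a; have := H a (mem_setT _).
by rewrite /mixed !big_ord_recl !big_ord0 /= !mulr0 !addr0.
Qed.

Lemma best_action2 (c e w : R) : exists be : grid, forall b,
  (1 - rate R true be) * w + rate R true be * (1 - rate R true be) * e
    + rate R true be ^+ 2 * c <=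
  (1 - rate R true b) * w + rate R true b * (1 - rate R true b) * e
    + rate R true b ^+ 2 * c.
Proof.
pose k i : R := match i with 0 => w | 1 => e | _ => c end.
have A0 : [set: action R] !=set0 by exists None.
have [be _ H] := compact_EVT_min A0 (@compact_action R) (@mixed_within true k).
exists be => b; have := H b (mem_setT _).
by rewrite /mixed !big_ord_recl !big_ord0 /= !addr0 !addrA.
Qed.

(** Backward induction.  The invariant 0 <= e <= w <= c, which makes waiting
    dominant in the one-shot games, is reproduced at each stage. *)
Lemma saddle_point N : forall th : nat -> R, (forall n, 0 <= th n) ->
  exists (W : nat -> site * site -> R) (a b : nat -> site * site -> grid),
  [/\ forall n z, 0 <= W n z,
      forall z, W N z = 0,
      forall n z y, (n < N)%N -> W n z <= th n * gain R z + mean (a n z) y (W n.+1) z,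
      forall n z x, (n < N)%N -> th n * gain R z + mean x (b n z) (W n.+1) z <= W n z &
      exists c e w, [/\ W 0%N = pot c e w, 0 <= e, e <= w & w <= c]].
Proof.
elim: N => [|N IH] th th0.
  exists (fun _ => pot 0 0 0), (fun _ _ => None), (fun _ _ => None).
  have W0 z : pot 0 0 0 z = 0 :> R.
    by rewrite /pot /level; case: (val _) => [|[|[|?]]] //; case: ifP.
  by split => //; [move=> _ z; rewrite W0|exists 0, 0, 0; split].
have [W [a [b [W0 WN Ha Hb [c [e [w [Wcew e0 ew wc]]]]]]]] :=
  IH (th \o S) (fun n => th0 n.+1).
have [al Hal] := best_action1 e w.
have [be Hbe] := best_action2 c e w.
pose e' := (1 - rate R false al) * e + rate R false al * (1 - rate R false al) * w.
pose m' := (1 - rate R true be) * w + rate R true be * (1 - rate R true be) * e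
  + rate R true be ^+ 2 * c.
have {}Hal a' : _ <= e' := Hal a'.
have {}Hbe b' : m' <= _ := Hbe b'.
pose V n := if n is m.+1 then W m else pot (th 0%N + c) e' (th 0%N + m').
have e'0 : 0 <= e'.
  by apply: le_trans e0 _; have := Hal None; rewrite -[rate _ _ None]/0; lra.
have e'm' : e' <= m'.
  have /andP[r0 r1] : 0 <= rate R false al <= 1 by rewrite rate_ge0 rate_le1.
  have /andP[s0 s1] : 0 <= rate R true be <= 1 by rewrite rate_ge0 rate_le1.
  rewrite /e' /m'; move: (rate R false al) (rate R true be) r0 r1 s0 s1 => r s r0 r1 s0 s1.
  (* 1 - r - s + r^2 + s^2 as a sum of squares. *)
  rewrite -subr_ge0 (_ : _ - _ = (w - e) * ((r - 2^-1) ^+ 2 + (s - 2^-1) ^+ 2 + 2^-1)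
     + s ^+ 2 * (c - w) + r ^+ 2 * e); last by field.
  by repeat first [lra | exact: sqr_ge0 | apply: mulr_ge0 | apply: addr_ge0].
have m'w : m' <= w by have := Hbe None; rewrite -[rate _ _ None]/0; lra.
exists V, (fun n => if n is m.+1 then a m else play1 al),
  (fun n => if n is m.+1 then b m else play2 be).
have Vth := th0 0%N.
split.
- case=> [|n] z //=.
  have := @pot_bounds R (th 0%N + c) e' (th 0%N + m') z e'0.
  by case/(_ _ _)/andP => //; lra.
- by [].
- case=> [|n] z y; last exact: Ha.
  move=> _; rewrite /= Wcew; apply: pot_le_mean => // b'.
  by rewrite lerD2l; exact: Hbe.
- case=> [|n] z x; last exact: Hb.
  by move=> _; rewrite /= Wcew; apply: mean_le_pot.
- by exists (th 0%N + c), e', (th 0%N + m'); split => //; lra.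
Qed.

Lemma weighted_saddle N (th : nat -> R) z : (forall n, 0 <= th n) ->
  exists (v : R) (sigma : strategy1 (game R)) (tau : strategy2 (game R)),
    (forall tau', v <= \sum_(n < N) th n * expected_payoff z sigma tau' n) /\
    (forall sigma', \sum_(n < N) th n * expected_payoff z sigma' tau n <= v).
Proof.
move=> th0; have [W [a [b [W0 WN Ha Hb _]]]] := saddle_point N th0.
exists (W 0%N z), (pure1 R a), (pure2 R b); split => [tau'|sigma'].
  have := guarantee1 th0 W0 Ha (M := 0); rewrite -[X in _ <= X]addr0; apply.
  by move=> s; rewrite WN.
exact: (guarantee2 th0 W0 Hb).
Qed.

Lemma game_values_exist : values_exist (game R).
Proof.
split=> [N z N1|lam z /andP[lam0 lam1]]; apply: approx_saddle_is_value => eps eps0.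
  have th0 (_ : nat) : 0 <= N%:R^-1 :> R by rewrite invr_ge0.
  have [v [sigma [tau [H1 H2]]]] := weighted_saddle N z th0.
  exists v, sigma, tau; rewrite /payoffN; split => [t|s]; rewrite mulr_sumr.
    by apply: le_trans (H1 t); rewrite gerBl ltW.
  by apply: le_trans (H2 s) _; rewrite lerDl ltW.
have th0 n : 0 <= lam * (1 - lam) ^+ n.
  by rewrite mulr_ge0 ?exprn_ge0 ?subr_ge0 // ltW.
have [|N HN] := @geometric_small R (1 - lam) eps _ eps0.
  by rewrite subr_ge0 lam1 gtrBl.
have [v [sigma [tau [H1 H2]]]] := weighted_saddle N z th0.
exists v, sigma, tau; rewrite /payoffL; split => [t|s].
  apply: le_trans (discounted_ge lam0 lam1 (expected_payoff_bounds _ _ _) N).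
  by apply: le_trans (H1 t); rewrite gerBl ltW.
apply: le_trans (discounted_le lam0 lam1 (expected_payoff_bounds _ _ _) N) _.
by apply: lerD; [exact: H2|exact: ltW].
Qed.

End dynamic_programming.

(** * Oscillation of the discounted values *)
Section oscillation.
Variable R : realType.
Local Notation G := (game R).

Lemma scale_le (k x y x' y' : R) :
  0 <= k -> x <= y -> x' = k * x -> y' = k * y -> x' <= y'.
Proof. by move=> k0 xy -> ->; exact: ler_wpM2l. Qed.

Section stationary.
Variables (lam e w : R).
Hypotheses (lam0 : 0 < lam) (lam1 : lam <= 1).
Hypotheses (e0 : 0 <= e) (ew : e <= w) (w1 : w <= 1).

Let q : R := 1 - lam.
Let W n := pot (q ^+ n) (q ^+ n * e) (q ^+ n * w).
Let q0 : 0 <= q. Proof. by rewrite subr_ge0. Qed.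
Let q1 : q < 1. Proof. by rewrite gtrBl. Qed.
Let th0 n : 0 <= lam * q ^+ n. Proof. by apply: mulr_ge0; [exact: ltW|exact: exprn_ge0]. Qed.

Let le1 n : 0 <= q ^+ n * e. Proof. by rewrite mulr_ge0 ?exprn_ge0. Qed.
Let le2 n : q ^+ n * e <= q ^+ n * w. Proof. by rewrite ler_wpM2l ?exprn_ge0. Qed.
Let le3 n : q ^+ n * w <= q ^+ n. Proof. by rewrite ler_piMr ?exprn_ge0. Qed.
Let W0 n z : 0 <= W n z.
Proof. by have /andP[] := pot_bounds z (le1 n) (le2 n) (le3 n). Qed.
Let Wq n z : W n z <= q ^+ n.
Proof. by have /andP[] := pot_bounds z (le1 n) (le2 n) (le3 n). Qed.

(** A stationary sub-solution bounds the discounted value from below, by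
    guarantee1 applied to W n = (1 - lam)^n pot 1 e w over longer and longer
    horizons. *)
Lemma discounted_value_ge (al : grid) :
  e <= q * ((1 - rate R false al) * e + rate R false al * (1 - rate R false al) * w) ->
  (forall b, w <= lam + q * ((1 - rate R true b) * w +
     rate R true b * (1 - rate R true b) * e + rate R true b ^+ 2)) ->
  forall z v, is_value (@payoffL R G lam z) v -> pot 1 e w z <= v.
Proof.
move=> He Hw z v vP; apply: (is_value_ge vP (s := pure1 R (fun=> play1 al))) => tau.
apply/ler_addgt0Pr => eps eps0.
have [|N HN] := @geometric_small R q eps _ eps0; first by rewrite q0.
apply: (@le_trans _ _ (\sum_(n < N) lam * q ^+ n *
    expected_payoff z (pure1 R (fun=> play1 al)) tau n + q ^+ N)); last first.
  apply: lerD; last exact: ltW.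
  exact: (discounted_ge lam0 lam1 (expected_payoff_bounds _ _ _)).
have -> : pot 1 e w z = W 0%N z by rewrite /W expr0 !mul1r.
apply: (guarantee1 th0 W0) => // n s b _.
have qn : 0 <= q ^+ n by exact: exprn_ge0.
apply: pot_le_mean => //.
- by rewrite exprS /q; lra.
- by apply: (scale_le qn He) => //; rewrite exprS; ring.
- by move=> b'; apply: (scale_le qn (Hw b')) => //; rewrite exprS; ring.
Qed.

Lemma discounted_value_le (be : grid) :
  (forall a, q * ((1 - rate R false a) * e + rate R false a * (1 - rate R false a) * w) <= e) ->
  lam + q * ((1 - rate R true be) * w +
     rate R true be * (1 - rate R true be) * e + rate R true be ^+ 2) <= w ->
  forall z v, is_value (@payoffL R G lam z) v -> v <= pot 1 e w z.
Proof.
move=> He Hw z v vP; apply: (is_value_le vP (t := pure2 R (fun=> play2 be))) => sigma.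
apply/ler_addgt0Pr => eps eps0.
have [|N HN] := @geometric_small R q eps _ eps0; first by rewrite q0.
apply: le_trans (discounted_le lam0 lam1 (expected_payoff_bounds _ _ _) N) _.
apply: lerD; last exact: ltW.
have -> : pot 1 e w z = W 0%N z by rewrite /W expr0 !mul1r.
apply: (guarantee2 th0 W0) => // n s a _.
have qn : 0 <= q ^+ n by exact: exprn_ge0.
apply: mean_le_pot => //.
- by rewrite exprS /q; lra.
- by move=> a'; apply: (scale_le qn (He a')) => //; rewrite exprS; ring.
- by apply: (scale_le qn Hw) => //; rewrite exprS; ring.
Qed.

End stationary.

(** Consecutive rates of the opponent differ by a factor 16 around each rate of
    the given player, which sits at their geometric mean. *)
Lemma rate_gap c n (a : grid) : (0 < n)%N ->
  4 * rate R c (Some n) <= rate R (~~ c) a \/ rate R (~~ c) a <= rate R c (Some n) / 4.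
Proof.
case: n => // n _; have r0 := rate_gt0 R c n.+1.
have r1 := rateS_le R c n; have r2 := rate_le1 R c (Some n).
case: a => [[|m]|]; last by right; rewrite -[rate _ _ None]/0; lra.
  by left; rewrite -[rate R (~~ c) _]/1; lra.
have x0 k : (0 : R) < 16 ^- k by rewrite invr_gt0 exprn_gt0.
have mono k l : (k <= l)%N -> (16 : R) ^- l <= 16 ^- k.
  by move=> kl; rewrite lef_pV2 ?posrE ?exprn_gt0 // ler_eXn2l // ltr1n.
have step k : (16 : R) ^- k.+1 = 16 ^- k / 16 by rewrite exprS invfM mulrC.
rewrite /rate /phase; have := x0 n.+1; have := x0 m.+1.
case: c {r0 r1 r2} => /=.
- have [/mono|/mono] := leqP m.+1 n; last by right; lra.
  by rewrite (step n); left; lra.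
- have [/mono|/mono] := leqP m.+1 n.+1; first by left; lra.
  by rewrite (step n.+1); right; lra.
Qed.

Lemma rate_small c (e : R) : 0 < e -> exists n, rate R c (Some n.+2) < e.
Proof.
move=> e0; have [|n] := @rate_cvg0 R (e / 4); first by rewrite divr_gt0.
exists n; have := rate_lipschitz R c (Some n.+2) None.
rewrite -[rate R c None]/0 -[rate R false None]/0 !subr0.
rewrite (ger0_norm (rate_ge0 _ _ _)) (ger0_norm (rate_ge0 _ _ _)).
have : rate R false (Some n.+2) <= rate R false (Some n) / 4 by exact: rate_le_quarter.
have := rate_gt0 R false n; lra.
Qed.

Lemma rateSS_le c n : rate R c (Some n.+2) <= 1 / 16.
Proof.
have := rateS_le R c n.+1; have := rateS_le R c n; have := rate_le1 R c (Some n).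
lra.
Qed.

(** Lead 0 and equal bits, where the value is the parameter e of the potential. *)
Definition origin : state1 G * state2 G := ((false, ord0), (false, ord0)).

Lemma pot_origin (c e w : R) : pot c e w origin = e.
Proof. by []. Qed.

(** The discount rate r^2 makes r the best rate of player 1.  With value 3/5 when
    the bits agree, flips at rate r cost 2 r * 3/5 = 12/10 r to first order; the
    difference 13/10 r between the two levels leaves room for higher orders.  To
    push the value lower, a rate s of player 2 would have to satisfy, to second
    order, 2/5 (s^2 + r^2) < 13/10 r s, which fails for s >= 4 r and s <= r / 4. *)
Lemma value_ge_three_fifths n v :
  is_value (@payoffL R G (rate R false (Some n.+2) ^+ 2) origin) v -> 3 / 5 <= v.
Proof.
have gap := @rate_gap false n.+2 _ isT.
have := rate_gt0 R false n.+2; have := rateSS_le false n.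
set al := Some n.+2 in gap *; move Er : (rate R false al) gap => r gap r16 r0 vP.
rewrite -(pot_origin 1 (3 / 5) (3 / 5 + 13 / 10 * r)).
apply: (@discounted_value_ge (r ^+ 2) _ _ _ _ _ _ _ al _ _ origin v vP);
  rewrite ?Er //; try lra.
- by rewrite exprn_gt0.
- by rewrite expr_le1 ?ltW //; lra.
- rewrite -subr_ge0 (_ : _ - _ = r ^+ 2 *
    ((1 / 10 - 13 / 10 * r - 7 / 10 * r ^+ 2) + 13 / 10 * r ^+ 3)); last by field.
  rewrite mulr_ge0 ?sqr_ge0 // addr_ge0 //; last first.
    by rewrite mulr_ge0 ?exprn_ge0 //; lra.
  nra.
- move=> b; have := gap b; have := rate_ge0 R true b; have := rate_le1 R true b.
  rewrite /=; move: (rate R true b) => s s1 s0 sgap.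
  rewrite -subr_ge0 (_ : _ - _ = r ^+ 2 * (2 / 5 - 13 / 10 * r) +
    (1 - r ^+ 2) * (s * (2 / 5 * s - 13 / 10 * r))); last by field.
  have r2 : 0 <= r ^+ 2 <= 1 / 256 by apply/andP; split; nra.
  have ? : 0 <= r ^+ 2 * (2 / 5 - 13 / 10 * r - 3 / 10).
    by rewrite mulr_ge0 ?sqr_ge0 //; lra.
  case: sgap => [sr|sr].
    rewrite addr_ge0 //; first by rewrite mulr_ge0 ?sqr_ge0 //; lra.
    by rewrite mulr_ge0 ?mulr_ge0 //; lra.
  have ? : - (3 / 10 * r ^+ 2) <= s * (2 / 5 * s - 13 / 10 * r) by nra.
  nra.
Qed.

(** The mirror image: s is the best rate of player 2, and the rates of player 1
    miss it by a factor at least 4. *)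
Lemma value_le_two_fifths n v :
  is_value (@payoffL R G (rate R true (Some n.+2) ^+ 2) origin) v -> v <= 2 / 5.
Proof.
have gap := @rate_gap true n.+2 _ isT.
have := rate_gt0 R true n.+2; have := rateSS_le true n.
set be := Some n.+2 in gap *; move Es : (rate R true be) gap => s gap s16 s0 vP.
apply: (@le_trans _ _ (2 / 5 - 13 / 10 * s)); last by lra.
rewrite -(pot_origin 1 (2 / 5 - 13 / 10 * s) (2 / 5)).
apply: (@discounted_value_le (s ^+ 2) _ _ _ _ _ _ _ be _ _ origin v vP);
  rewrite ?Es //; try lra.
- by rewrite exprn_gt0.
- by rewrite expr_le1 ?ltW //; lra.
- move=> a; have := gap a; have := rate_ge0 R false a; have := rate_le1 R false a.
  rewrite /=; move: (rate R false a) => r r1 r0 rgap.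
  rewrite -subr_ge0 (_ : _ - _ = s ^+ 2 * (2 / 5 - 13 / 10 * s) +
    (1 - s ^+ 2) * (r * (2 / 5 * r - 13 / 10 * s))); last by field.
  have s2 : 0 <= s ^+ 2 <= 1 / 256 by apply/andP; split; nra.
  have ? : 0 <= s ^+ 2 * (2 / 5 - 13 / 10 * s - 3 / 10).
    by rewrite mulr_ge0 ?sqr_ge0 //; lra.
  case: rgap => [sr|sr].
    rewrite addr_ge0 //; first by rewrite mulr_ge0 ?sqr_ge0 //; lra.
    by rewrite mulr_ge0 ?mulr_ge0 //; lra.
  have ? : - (3 / 10 * s ^+ 2) <= r * (2 / 5 * r - 13 / 10 * s) by nra.
  nra.
- rewrite -subr_ge0 (_ : _ - _ = s ^+ 2 *
    ((1 / 10 - 13 / 10 * s - 7 / 10 * s ^+ 2) + 13 / 10 * s ^+ 3)); last by field.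
  rewrite mulr_ge0 ?sqr_ge0 // addr_ge0 //; last first.
    by rewrite mulr_ge0 ?exprn_ge0 //; lra.
  nra.
Qed.

Lemma no_asymptotic_value : ~ has_asymptotic_value G.
Proof.
move=> [vN [vL [v [_ vLP _ cvgL]]]].
have /cvgrPdist_lt /(_ (1 / 20)) := cvgL origin.
have e20 : (0 : R) < 1 / 20 by lra.
move=> /(_ e20) [d /= d0 Hd].
have near_v c n : rate R c (Some n.+2) < d ->
    `|v origin - vL (rate R c (Some n.+2) ^+ 2) origin| < 1 / 20.
  have := rate_gt0 R c n.+2; have := rate_le1 R c (Some n.+2).
  move: (rate _ _ _) => r r1 r0 rd; apply: Hd => /=; last by rewrite exprn_gt0.
  rewrite sub0r normrN ger0_norm ?sqr_ge0 //; apply: le_lt_trans rd.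
  by rewrite expr2 ler_piMl // ltW.
have isv c n : is_value (@payoffL R G (rate R c (Some n.+2) ^+ 2) origin)
    (vL (rate R c (Some n.+2) ^+ 2) origin).
  apply: vLP; rewrite exprn_gt0 ?rate_gt0 //=.
  by rewrite expr_le1 ?rate_le1 ?rate_ge0.
have [n /near_v] := rate_small false d0.
have [m /near_v] := rate_small true d0.
have := value_ge_three_fifths (isv false n).
have := value_le_two_fifths (isv true m).
by rewrite !ltr_norml => ? ? /andP[? ?] /andP[? ?]; lra.
Qed.

End oscillation.

Theorem theorem3p4 (R : realType) :
  exists G : product_game R,
    [/\ weakly_communicating (trans1 G),
        weakly_communicating (trans2 G),
        values_exist G &
        ~ has_asymptotic_value G].
Proof.
exists (game R); split.
- exact: trans_weakly_communicating.
- exact: trans_weakly_communicating.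
- exact: game_values_exist.
- exact: no_asymptotic_value.
Qed.
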